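(* For every $-1<\alpha<+\infty$, $-1<\beta\le 0$ and $z\in\mathbb D$, writing $t=|z|^2$, we have $$\varrho^2_{\alpha,\beta}(z)=-\beta\frac{(1-t)^\alpha}{H_{\alpha,\beta}^2(t)}\left((\alpha+\beta+1)H_{\alpha,\beta}(t)-\frac{\beta(\alpha+\beta+2)}{1+\beta}H_{\alpha,\beta+1}(t)\right)+\frac{\alpha+2}{(1-t)^2}.$$ In particular, if $\alpha\in\mathbb N$, then $$\frac{\alpha+2}{(1-|z|^2)^2}\le\varrho^2_{\alpha,\beta}(z)\le\frac{\alpha+\beta+2}{1+\beta}\,\frac{1}{(1-|z|^2)^2}.$$
   Context: $\mathbb D$ is the open unit disc in $\mathbb C$ and $\mathbb N=\{0,1,2,\dots\}$. For $\alpha,\beta>-1$ and $\xi\in\mathbb D$, $$H_{\alpha,\beta}(\xi)=\beta\sum_{n=0}^{+\infty}\frac{(-1)^n}{n+\beta}\binom{\alpha+1}{n}\xi^n,$$ the $n=0$ term being $\beta/\beta=1$, so that $H_{\alpha,0}\equiv 1$. For $-1<\beta\le 0$ the Bergman kernel of the $\beta$-modified Bergman space is $$\mathbb K_{\alpha,\beta}(w,z)=\frac{Q_{\alpha,\beta}(w\overline z)}{(1-w\overline z)^{2+\alpha}},\qquad w,z\in\mathbb D,$$ where, for these $\beta$, $Q_{\alpha,\beta}=H_{\alpha,\beta}$. One sets $\kappa_{\alpha,\beta}(z)=\log\mathbb K_{\alpha,\beta}(z,z)$ and $$\varrho^2_{\alpha,\beta}(z)=\frac{\partial^2\kappa_{\alpha,\beta}}{\partial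 z\,\partial\overline z}(z),\qquad z\in\mathbb D.$$ *)

(* Defs.v *)
From Stdlib Require Import Reals.
From Coquelicot Require Import Coquelicot.
Open Scope R_scope.

Fixpoint gbinom (x : R) (n : nat) : R :=
  match n with
  | O => 1
  | S m => gbinom x m * (x - INR m) / INR n
  end.

(* The norm of C is equivalent to the product norm, so a convergent complex
   series is summed componentwise. *)
Definition CSeries (a : nat -> C) : C :=
  (Series (fun n => Re (a n)), Series (fun n => Im (a n))).

Lemma CSeries_unique (a : nat -> C) (l : C) :
  is_series (V := C_R_NormedModule) a l -> CSeries a = l.
Proof.
intros Ha; destruct l as [lr li]; unfold CSeries; f_equal;
  apply is_series_unique.
- apply filterlim_ext with (fun n => Re (sum_n (G := C_AbelianMonoid) a n)).
  + intros n; induction n as [|n IH].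
    * now rewrite !sum_O.
    * rewrite !sum_Sn, <- IH; reflexivity.
  + refine (filterlim_comp _ _ _ _ Re _ _ _ Ha _).
    apply (filterlim_locally (F := locally (lr, li)) Re lr).
    intros eps; exists eps; intros y Hy; exact (proj1 Hy).
- apply filterlim_ext with (fun n => Im (sum_n (G := C_AbelianMonoid) a n)).
  + intros n; induction n as [|n IH].
    * now rewrite !sum_O.
    * rewrite !sum_Sn, <- IH; reflexivity.
  + refine (filterlim_comp _ _ _ _ Im _ _ _ Ha _).
    apply (filterlim_locally (F := locally (lr, li)) Im li).
    intros eps; exists eps; intros y Hy; exact (proj2 Hy).
Qed.

(* The coefficient of index 0 is beta / beta = 1, also for beta = 0, where
   Rocq's total division would give 0. *)
Definition Hcoef (alpha beta : R) (n : nat) : R :=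
  match n with
  | O => 1
  | S _ => beta * ((-1) ^ n / (INR n + beta) * gbinom (alpha + 1) n)
  end.

Definition H (alpha beta : R) (xi : C) : C :=
  CSeries (fun n => (Hcoef alpha beta n * xi ^ n)%C).

(* Principal argument, with values in (-PI, PI]; meaningful for z <> 0. *)
Definition Carg (z : C) : R :=
  if Rlt_dec (Im z) 0 then - acos (Re z / Cmod z) else acos (Re z / Cmod z).

Definition Clog (z : C) : C := (ln (Cmod z), Carg z).

Definition Cexp (z : C) : C :=
  (exp (Re z) * cos (Im z), exp (Re z) * sin (Im z)).

(* Principal power with real exponent; meaningful for z <> 0. *)
Definition Cpower (z : C) (a : R) : C := Cexp (a * Clog z)%C.

(* Bergman kernel for -1 < beta <= 0, where Q_{alpha,beta} = H_{alpha,beta}. *)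
Definition K (alpha beta : R) (w z : C) : C :=
  (H alpha beta (w * Cconj z) / Cpower (1 - w * Cconj z) (2 + alpha))%C.

Definition kappa (alpha beta : R) (z : C) : C := Clog (K alpha beta z z).

Definition Dx (f : C -> C) (z : C) : C :=
  (Derive (fun x => Re (f (x, Im z))) (Re z),
   Derive (fun x => Im (f (x, Im z))) (Re z)).

Definition Dy (f : C -> C) (z : C) : C :=
  (Derive (fun y => Re (f (Re z, y))) (Im z),
   Derive (fun y => Im (f (Re z, y))) (Im z)).

(* Derive is total; this says that the two partial derivatives exist. *)
Definition ex_partials (f : C -> C) (z : C) : Prop :=
  ex_derive (V := C_R_NormedModule) (fun x : R => f (x, Im z)) (Re z) /\
  ex_derive (V := C_R_NormedModule) (fun y : R => f (Re z, y)) (Im z).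

(* Wirtinger derivatives. *)
Definition D_z (f : C -> C) (z : C) : C := ((Dx f z - Ci * Dy f z) / 2)%C.

Definition D_zbar (f : C -> C) (z : C) : C := ((Dx f z + Ci * Dy f z) / 2)%C.

Definition rho2 (alpha beta : R) (z : C) : C :=
  D_z (D_zbar (kappa alpha beta)) z.

(* Main.v *)
Require Import Defs.
From Stdlib Require Import Reals Lra Lia.
From Coquelicot Require Import Coquelicot.
Open Scope R_scope.

(** For [t] in [[0, 1)] the value of [H alpha beta] at [t] is a real power
    series [h t], so on the diagonal the logarithm of the kernel is the radial
    function [log_kernel (|z|^2)] with
    [log_kernel t = ln (h t) - (2 + alpha) ln (1 - t)].  For a radial function
    [phi (|z|^2)] the operator d^2/(dz dzbar) gives the derivative of
    [t * phi' t] at [t = |z|^2] ([radial_D_z_D_zbar]), and everything becomes a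
    question about one real variable.

    Two linear relations, both read off the coefficients, govern [h]
    ([h_euler] and [h_contiguous]):
    -  [t h' = beta ((1 - t)^(alpha+1) - h)], where the binomial series has been
       summed ([PSeries_binom_coef]);
    -  [(1 - t) h' = beta h - beta k g], where [g] is [h] with [beta + 1] in
       place of [beta] and [k = (alpha + beta + 2) / (1 + beta)].

    By the first one, [t * log_kernel' t] is
    [beta ((1 - t)^(alpha+1) / h - 1) + (2 + alpha) t / (1 - t)].  It contains
    no derivative of [h], so differentiating it once more and removing [h'] with
    the second relation gives the announced formula
    ([is_derive_euler_log_kernel]).

    Positivity comes from the same relations.  The first one makes
    [t^(beta+1) g] nondecreasing, so [g >= 0] ([h_nonneg]); the second one then
    makes [(1 - t)^beta h] nondecreasing, so [h >= (1 - t)^(-beta) > 0]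
    ([h_lower_bound]), and the logarithm is legitimate.  Finally the first
    relation for both parameters makes [t^(beta+1) (h - g)] nondecreasing, so
    [g <= h] ([h_shift_le]).

    For the inequalities, let [E] be the last factor of the formula,
    [E = (alpha + beta + 1) h - beta k g].  When [alpha + beta + 1 >= 0], in
    particular when [alpha] is a natural number, [E >= 0], which is the lower
    bound.  Moreover [g <= h] turns into [E <= (alpha + 1) / (1 + beta) h], and
    [(1 - t)^(alpha+2) <= (1 - t)^(-beta) <= h]; the product of the two is the
    upper bound ([rho2_formula_bounds]). *)

(** * The power series of H on the real interval *)

Lemma eventually_nonincreasing_bounded (u : nat -> R) (N : nat) :
  (forall n, (N <= n)%nat -> Rabs (u (S n)) <= Rabs (u n)) ->
  exists M, forall n, Rabs (u n) <= M.
Proof.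
revert u; induction N as [|N IH]; intros u Hu.
- exists (Rabs (u 0%nat)); intros n; induction n as [|n IHn]; [lra|].
  apply Rle_trans with (2 := IHn), Hu; lia.
- destruct (IH (fun n => u (S n))) as [M HM].
  { intros n Hn; apply Hu; lia. }
  exists (Rmax (Rabs (u 0%nat)) M); intros [|n].
  + apply Rmax_l.
  + apply Rle_trans with (1 := HM n), Rmax_r.
Qed.

(** The ratio of consecutive coefficients is [(x - n) / (n + 1)], of modulus at
    most 1 as soon as [x <= 2 n + 1].  A ratio test would not do, since the
    coefficients vanish eventually when [x] is a natural number. *)
Lemma gbinom_bounded (x : R) :
  0 < x -> exists M, forall n, Rabs (gbinom x n) <= M.
Proof.
intros Hx.
destruct (INR_unbounded x) as [N HN].
apply eventually_nonincreasing_bounded with N; intros n Hn.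
apply le_INR in Hn.
change (gbinom x (S n)) with (gbinom x n * (x - INR n) / INR (S n)).
rewrite S_INR.
assert (Hn0 := pos_INR n).
unfold Rdiv; rewrite Rmult_assoc, Rabs_mult.
rewrite <- (Rmult_1_r (Rabs (gbinom x n))) at 2.
apply Rmult_le_compat_l; [apply Rabs_pos|].
rewrite Rabs_mult, Rabs_inv, (Rabs_right (INR n + 1)) by lra.
apply Rmult_le_reg_r with (INR n + 1); [lra|].
rewrite Rmult_assoc, Rinv_l by lra.
rewrite Rmult_1_r, Rmult_1_l; apply Rabs_le; lra.
Qed.

Definition radius_ge_1 (a : nat -> R) : Prop :=
  forall t, Rabs t < 1 -> Rbar_lt (Rabs t) (CV_radius a).

Lemma bounded_radius_ge_1 (a : nat -> R) (M : R) :
  (forall n, Rabs (a n) <= M) -> radius_ge_1 a.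
Proof.
intros HM t Ht.
apply Rbar_lt_le_trans with (Finite 1); [exact Ht|].
apply (proj1 (CV_radius_bounded a)).
exists M; intros n; rewrite pow1, Rmult_1_r; apply HM.
Qed.

(** Coefficients of the expansion of [(1 - t)^(alpha+1)]. *)
Definition binom_coef (alpha : R) (n : nat) : R :=
  (-1) ^ n * gbinom (alpha + 1) n.

Lemma Rabs_binom_coef (alpha : R) (n : nat) :
  Rabs (binom_coef alpha n) = Rabs (gbinom (alpha + 1) n).
Proof.
unfold binom_coef; rewrite Rabs_mult, pow_1_abs; ring.
Qed.

Lemma binom_coef_S (alpha : R) (n : nat) :
  (INR n + 1) * binom_coef alpha (S n)
  = (INR n - (alpha + 1)) * binom_coef alpha n.
Proof.
unfold binom_coef.
change (gbinom (alpha + 1) (S n))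
  with (gbinom (alpha + 1) n * (alpha + 1 - INR n) / INR (S n)).
rewrite S_INR, <- tech_pow_Rmult; field.
assert (H0 := pos_INR n); lra.
Qed.

Lemma binom_coef_radius_ge_1 (alpha : R) : -1 < alpha -> radius_ge_1 (binom_coef alpha).
Proof.
intros Ha; destruct (gbinom_bounded (alpha + 1)) as [M HM]; [lra|].
apply bounded_radius_ge_1 with M; intros n; rewrite Rabs_binom_coef; apply HM.
Qed.

Lemma INR_plus_pos (beta : R) (n : nat) : -1 < beta -> 0 < INR (S n) + beta.
Proof. intros Hb; rewrite S_INR; assert (H0 := pos_INR n); lra. Qed.

(** The division-free form of the definition of [Hcoef]; the convention
    [beta / beta = 1] is what makes it true for [n = 0] and [beta = 0]. *)
Lemma Hcoef_binom_coef (alpha beta : R) (n : nat) : -1 < beta ->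
  (INR n + beta) * Hcoef alpha beta n = beta * binom_coef alpha n.
Proof.
intros Hb; destruct n as [|n].
- unfold binom_coef; simpl; ring.
- unfold Hcoef, binom_coef.
  assert (H0 := INR_plus_pos beta n Hb).
  field; lra.
Qed.

Lemma Hcoef_radius_ge_1 (alpha beta : R) :
  -1 < alpha -> -1 < beta -> radius_ge_1 (Hcoef alpha beta).
Proof.
intros Ha Hb; destruct (gbinom_bounded (alpha + 1)) as [M HM]; [lra|].
assert (HM0 : 0 <= M) by (apply Rle_trans with (2 := HM 0%nat), Rabs_pos).
apply bounded_radius_ge_1 with (Rmax 1 (Rabs beta * (M / (1 + beta)))); intros [|n].
- apply Rle_trans with (2 := Rmax_l _ _); simpl; rewrite Rabs_R1; lra.
- apply Rle_trans with (2 := Rmax_r _ _).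
  unfold Hcoef; rewrite Rabs_mult.
  apply Rmult_le_compat_l; [apply Rabs_pos|].
  assert (H0 := INR_plus_pos beta n Hb).
  replace ((-1) ^ S n / (INR (S n) + beta) * gbinom (alpha + 1) (S n))
    with (binom_coef alpha (S n) * / (INR (S n) + beta))
    by (unfold binom_coef, Rdiv; ring).
  rewrite Rabs_mult, Rabs_binom_coef, Rabs_inv, (Rabs_right (INR (S n) + beta))
    by lra.
  apply Rmult_le_compat; [apply Rabs_pos| |apply HM|].
  + apply Rlt_le, Rinv_0_lt_compat, H0.
  + apply Rinv_le_contravar; [lra|].
    rewrite S_INR; assert (H1 := pos_INR n); lra.
Qed.

Lemma is_pseries_in_disc (a : nat -> R) (t : R) :
  radius_ge_1 a -> Rabs t < 1 -> is_pseries a t (PSeries a t).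
Proof. intros Ha Ht; apply PSeries_correct, CV_radius_inside, Ha, Ht. Qed.

Lemma radius_ge_1_derive (a : nat -> R) : radius_ge_1 a -> radius_ge_1 (PS_derive a).
Proof. intros Ha t Ht; rewrite CV_radius_derive; apply Ha, Ht. Qed.

(** Together with [is_pseries_lin] and [is_pseries_eq], this reduces a linear
    differential relation with affine coefficients to an identity between
    coefficients. *)
Lemma is_pseries_euler (a : nat -> R) (t : R) :
  radius_ge_1 a -> Rabs t < 1 ->
  is_pseries (fun n => INR n * a n) t (t * PSeries (PS_derive a) t).
Proof.
intros Ha Ht.
apply is_pseries_ext with (PS_incr_1 (PS_derive a)).
- intros [|n]; simpl.
  + unfold zero; simpl; ring.
  + reflexivity.
- apply (is_pseries_incr_1 (V := R_NormedModule)).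
  apply is_pseries_in_disc; [apply radius_ge_1_derive, Ha|exact Ht].
Qed.

Lemma is_pseries_lin (a b : nat -> R) (c d t x y : R) :
  is_pseries a t x -> is_pseries b t y ->
  is_pseries (fun n => c * a n + d * b n) t (c * x + d * y).
Proof.
intros Hx Hy.
apply (is_pseries_plus (V := R_NormedModule) (PS_scal c a) (PS_scal d b));
  apply (is_pseries_scal (V := R_NormedModule)); try assumption;
  apply Rmult_comm.
Qed.

Lemma is_pseries_eq (a b : nat -> R) (t x y : R) :
  (forall n, a n = b n) -> is_pseries a t x -> is_pseries b t y -> x = y.
Proof.
intros Hab Hx Hy.
rewrite <- (is_pseries_unique _ _ _ Hx), <- (is_pseries_unique _ _ _ Hy).
now apply PSeries_ext.
Qed.

(** The restriction of [H alpha beta] to real arguments, see [H_RtoC]. *)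
Definition h (alpha beta : R) : R -> R := PSeries (Hcoef alpha beta).
Definition h' (alpha beta : R) : R -> R :=
  PSeries (PS_derive (Hcoef alpha beta)).

Lemma is_derive_Rpower_one_minus (a t : R) : t < 1 ->
  is_derive (fun s => Rpower (1 - s) a) t (- a * (Rpower (1 - t) a / (1 - t))).
Proof.
intros Ht; unfold Rpower; auto_derive; [lra|].
unfold Rminus; field; lra.
Qed.

(** Both sides solve [(1 - t) y' = - (alpha + 1) y] with [y 0 = 1]: the quotient
    has zero derivative. *)
Lemma PSeries_binom_coef (alpha t : R) : -1 < alpha -> Rabs t < 1 ->
  PSeries (binom_coef alpha) t = Rpower (1 - t) (alpha + 1).
Proof.
intros Ha Ht.
set (B := PSeries (binom_coef alpha)).
set (B' := PSeries (PS_derive (binom_coef alpha))).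
assert (HB := binom_coef_radius_ge_1 alpha Ha).
assert (Hode : forall s, Rabs s < 1 -> (1 - s) * B' s = - (alpha + 1) * B s).
{ intros s Hs.
  apply Rplus_eq_reg_l with (s * B' s).
  transitivity (1 * B' s + 0 * B s); [ring|].
  transitivity (1 * (s * B' s) + - (alpha + 1) * B s); [|ring].
  eapply is_pseries_eq.
  2: apply (is_pseries_lin _ _ _ _ _ _ _
       (is_pseries_in_disc _ _ (radius_ge_1_derive _ HB) Hs)
       (is_pseries_in_disc _ _ HB Hs)).
  2: apply (is_pseries_lin _ _ _ _ _ _ _
       (is_pseries_euler _ _ HB Hs) (is_pseries_in_disc _ _ HB Hs)).
  intros n; unfold PS_derive; rewrite S_INR.
  transitivity ((INR n + 1) * binom_coef alpha (S n)); [ring|].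
  rewrite binom_coef_S; ring. }
set (q := fun s => B s * Rpower (1 - s) (- (alpha + 1))).
assert (Hq : q t = q 0).
{ destruct (MVT_gen q 0 t (fun _ => 0)) as [c [_ Hc]].
  - intros s Hs.
    assert (Hs1 : Rabs s < 1).
    { apply Rabs_def1; apply Rabs_def2 in Ht;
        unfold Rmin, Rmax in Hs; destruct Rle_dec; lra. }
    assert (Hd := is_derive_PSeries _ _ (HB s Hs1)).
    apply Rabs_def2 in Hs1 as Hs2.
    evar_last.
    + apply (is_derive_mult B (fun s => Rpower (1 - s) (- (alpha + 1))) s).
      * exact Hd.
      * apply is_derive_Rpower_one_minus; lra.
      * intros; apply Rmult_comm.
    + fold B'; unfold plus, mult; simpl.
      apply Rmult_eq_reg_l with (1 - s); [|lra].
      rewrite Rmult_plus_distr_l, <- Rmult_assoc, (Hode s Hs1).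
      field; lra.
  - intros s Hs.
    assert (Hs1 : Rabs s < 1).
    { apply Rabs_def1; apply Rabs_def2 in Ht;
        unfold Rmin, Rmax in Hs; destruct Rle_dec; lra. }
    apply Rabs_def2 in Hs1 as Hs2.
    apply continuity_pt_filterlim, (ex_derive_continuous (V := R_NormedModule)).
    apply (ex_derive_mult B (fun s => Rpower (1 - s) (- (alpha + 1))) s).
    + eexists; apply (is_derive_PSeries _ _ (HB s Hs1)).
    + eexists; apply is_derive_Rpower_one_minus; lra.
  - lra. }
assert (H1 : q 0 = 1).
{ unfold q, B; rewrite PSeries_0, Rminus_0_r; unfold binom_coef, Rpower; simpl.
  rewrite ln_1, Rmult_0_r, exp_0; ring. }
rewrite H1 in Hq; unfold q in Hq; rewrite Rpower_Ropp in Hq.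
assert (Hp : 0 < Rpower (1 - t) (alpha + 1)) by apply exp_pos.
apply Rmult_eq_reg_r with (/ Rpower (1 - t) (alpha + 1)).
- rewrite Rinv_r by lra; exact Hq.
- apply Rinv_neq_0_compat; lra.
Qed.

Lemma h_0 (alpha beta : R) : h alpha beta 0 = 1.
Proof. unfold h; rewrite PSeries_0; reflexivity. Qed.

Lemma is_derive_h (alpha beta t : R) :
  -1 < alpha -> -1 < beta -> Rabs t < 1 -> is_derive (h alpha beta) t (h' alpha beta t).
Proof. intros Ha Hb Ht; apply is_derive_PSeries, Hcoef_radius_ge_1; assumption. Qed.

Lemma ex_derive_h' (alpha beta t : R) :
  -1 < alpha -> -1 < beta -> Rabs t < 1 -> ex_derive (h' alpha beta) t.
Proof.
intros Ha Hb Ht; eexists; apply is_derive_PSeries, radius_ge_1_derive; [|exact Ht].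
apply Hcoef_radius_ge_1; assumption.
Qed.

(** Equivalent to [(t^beta h)' = beta t^(beta-1) (1 - t)^(alpha+1)]: multiplying
    the coefficients by [n + beta] removes the denominators of [Hcoef]. *)
Lemma h_euler (alpha beta t : R) :
  -1 < alpha -> -1 < beta -> Rabs t < 1 ->
  t * h' alpha beta t
  = beta * (Rpower (1 - t) (alpha + 1) - h alpha beta t).
Proof.
intros Ha Hb Ht; rewrite <- PSeries_binom_coef by assumption.
assert (HH := Hcoef_radius_ge_1 alpha beta Ha Hb).
assert (HB := binom_coef_radius_ge_1 alpha Ha).
transitivity (1 * (t * h' alpha beta t) + 0 * h alpha beta t); [ring|].
rewrite Rmult_minus_distr_l; unfold Rminus; rewrite Ropp_mult_distr_l.
eapply is_pseries_eq.
2: apply (is_pseries_lin _ _ _ _ _ _ _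
     (is_pseries_euler _ _ HH Ht) (is_pseries_in_disc _ _ HH Ht)).
2: apply (is_pseries_lin _ _ _ _ _ _ _
     (is_pseries_in_disc _ _ HB Ht) (is_pseries_in_disc _ _ HH Ht)).
intros n; cbv beta; rewrite <- (Hcoef_binom_coef alpha beta n Hb); ring.
Qed.

(** After multiplication by [n + 1 + beta] the coefficient identity is
    [- (alpha + 1 - n) = (n + 1 + beta) - (alpha + beta + 2)]. *)
Lemma h_contiguous (alpha beta t : R) :
  -1 < alpha -> -1 < beta -> Rabs t < 1 ->
  (1 - t) * h' alpha beta t
  = beta * h alpha beta t
    - beta * (alpha + beta + 2) / (1 + beta) * h alpha (beta + 1) t.
Proof.
intros Ha Hb Ht.
assert (HH := Hcoef_radius_ge_1 alpha beta Ha Hb).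
assert (HG : radius_ge_1 (Hcoef alpha (beta + 1))) by (apply Hcoef_radius_ge_1; lra).
transitivity (1 * h' alpha beta t + (-1) * (t * h' alpha beta t)); [ring|].
unfold Rminus; rewrite Ropp_mult_distr_l.
eapply is_pseries_eq.
2: apply (is_pseries_lin _ _ _ _ _ _ _
     (is_pseries_in_disc _ _ (radius_ge_1_derive _ HH) Ht)
     (is_pseries_euler _ _ HH Ht)).
2: apply (is_pseries_lin _ _ _ _ _ _ _
     (is_pseries_in_disc _ _ HH Ht) (is_pseries_in_disc _ _ HG Ht)).
intros n; cbv beta; unfold PS_derive.
assert (Hn := pos_INR n).
apply Rmult_eq_reg_l with (INR n + 1 + beta); [|lra].
assert (E1 := Hcoef_binom_coef alpha beta n Hb).
assert (E2 := Hcoef_binom_coef alpha beta (S n) Hb).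
assert (E3 := Hcoef_binom_coef alpha (beta + 1) n ltac:(lra)).
assert (E4 := binom_coef_S alpha n).
rewrite S_INR in *.
replace ((INR n + 1 + beta) *
  (1 * ((INR n + 1) * Hcoef alpha beta (S n)) + -1 * (INR n * Hcoef alpha beta n)))
  with ((INR n + 1) * ((INR n + 1 + beta) * Hcoef alpha beta (S n))
        - (INR n + 1 + beta) * ((INR n + beta) * Hcoef alpha beta n)
        + (INR n + 1 + beta) * beta * Hcoef alpha beta n) by ring.
replace ((INR n + 1 + beta) *
  (beta * Hcoef alpha beta n +
   - (beta * (alpha + beta + 2) / (1 + beta)) * Hcoef alpha (beta + 1) n))
  with ((INR n + 1 + beta) * beta * Hcoef alpha beta n
    - beta * (alpha + beta + 2) / (1 + beta)
      * ((INR n + (beta + 1)) * Hcoef alpha (beta + 1) n)) by ring.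
rewrite E1, E2, E3.
replace ((INR n + 1) * (beta * binom_coef alpha (S n)))
  with (beta * ((INR n + 1) * binom_coef alpha (S n))) by ring.
rewrite E4; field; lra.
Qed.

(** * Positivity and comparison *)

Lemma derive_nonneg_le (f f' : R -> R) (a b : R) : a <= b ->
  (forall s, a <= s <= b -> is_derive f s (f' s)) ->
  (forall s, a <= s <= b -> 0 <= f' s) -> f a <= f b.
Proof.
intros Hab Hd Hf'.
destruct (MVT_gen f a b f') as [c [Hc Heq]];
  rewrite ?Rmin_left, ?Rmax_right in * by assumption.
- intros s Hs; apply Hd; lra.
- intros s Hs; apply continuity_pt_filterlim.
  apply (ex_derive_continuous (V := R_NormedModule)).
  eexists; apply Hd, Hs.
- assert (H0 := Rmult_le_pos _ _ (Hf' c Hc) (proj1 (Rminus_le_0 a b) Hab)).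
  lra.
Qed.

Lemma Rpower_pos (x a : R) : 0 < Rpower x a.
Proof. apply exp_pos. Qed.

(** The hypothesis says that [t^gamma y] is nondecreasing.  If [y t < 0], then
    [y s <= (t/s)^gamma y t <= y t] for all [0 < s < t], against the continuity
    of [y] at 0, where [y] is nonnegative. *)
Lemma euler_nonneg (y y' : R -> R) (gamma : R) : 0 < gamma -> 0 <= y 0 ->
  (forall s, 0 <= s < 1 -> is_derive y s (y' s)) ->
  (forall s, 0 < s < 1 -> 0 <= s * y' s + gamma * y s) ->
  forall t, 0 <= t < 1 -> 0 <= y t.
Proof.
intros Hg Hy0 Hd Hode t Ht.
destruct (Rle_lt_dec 0 (y t)) as [Hyt|Hyt]; [exact Hyt|exfalso].
assert (Ht0 : 0 < t).
{ destruct (Req_dec t 0) as [->|]; lra. }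
assert (Hleft : forall s, 0 < s < t -> y s <= y t).
{ intros s Hs.
  assert (Hq : Rpower s gamma * y s <= Rpower t gamma * y t).
  { apply (derive_nonneg_le (fun r => Rpower r gamma * y r)
      (fun r => Rpower r gamma / r * (r * y' r + gamma * y r))); [lra| |].
    - intros r Hr; evar_last.
      + apply (is_derive_mult (fun r => Rpower r gamma) y r).
        * unfold Rpower; auto_derive; [lra|reflexivity].
        * apply Hd; lra.
        * intros; apply Rmult_comm.
      + unfold plus, mult; simpl; fold (Rpower r gamma); field; lra.
    - intros r Hr; apply Rmult_le_pos; [|apply Hode; lra].
      apply Rlt_le, Rdiv_lt_0_compat; [apply Rpower_pos|lra]. }
  assert (Hp : Rpower s gamma <= Rpower t gamma)
    by (apply Rle_Rpower_l; lra).
  apply Rmult_le_reg_l with (Rpower s gamma); [apply Rpower_pos|].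
  nra. }
assert (Hc : continuous y 0).
{ apply (ex_derive_continuous (V := R_NormedModule)).
  eexists; apply Hd; lra. }
destruct (proj1 (filterlim_locally y (y 0)) Hc
  (mkposreal (- y t) ltac:(lra))) as [d Hdelta].
set (s := Rmin d t / 2).
assert (Hd0 := cond_pos d).
assert (Hs : 0 < s < t /\ s < d).
{ unfold s, Rmin; destruct Rle_dec; lra. }
assert (Hball : ball 0 d s).
{ apply Rabs_lt_between'; lra. }
apply Hdelta in Hball.
apply Rabs_lt_between' in Hball; simpl in Hball.
assert (H1 := Hleft s (proj1 Hs)); lra.
Qed.

Lemma Rabs_unit (t : R) : 0 <= t < 1 -> Rabs t < 1.
Proof. intros Ht; rewrite Rabs_right; lra. Qed.

Lemma h_nonneg (alpha gamma t : R) :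
  -1 < alpha -> 0 < gamma -> 0 <= t < 1 -> 0 <= h alpha gamma t.
Proof.
intros Ha Hg; revert t.
apply euler_nonneg with (h' alpha gamma) gamma; [exact Hg| | |].
- rewrite h_0; lra.
- intros s Hs; apply is_derive_h; [lra|lra|apply Rabs_unit, Hs].
- intros s Hs; rewrite h_euler by (try apply Rabs_unit; lra).
  replace (_ + _) with (gamma * Rpower (1 - s) (alpha + 1)) by ring.
  apply Rmult_le_pos; [lra|apply Rlt_le, Rpower_pos].
Qed.

(** By [h_contiguous], the derivative of [(1 - t)^beta h] is
    [(1 - t)^(beta-1)] times a nonnegative multiple of the series with parameter
    [beta + 1], which is nonnegative by [h_nonneg]. *)
Lemma h_lower_bound (alpha beta t : R) :
  -1 < alpha -> -1 < beta <= 0 -> 0 <= t < 1 ->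
  Rpower (1 - t) (- beta) <= h alpha beta t.
Proof.
intros Ha Hb Ht.
assert (Hq : 1 <= h alpha beta t * Rpower (1 - t) beta).
{ replace 1 with (h alpha beta 0 * Rpower (1 - 0) beta) at 1.
  2: rewrite h_0, Rminus_0_r; unfold Rpower;
     rewrite ln_1, Rmult_0_r, exp_0; ring.
  apply (derive_nonneg_le (fun s => h alpha beta s * Rpower (1 - s) beta)
    (fun s => Rpower (1 - s) beta / (1 - s) *
       (- beta * (alpha + beta + 2) / (1 + beta) * h alpha (beta + 1) s)));
    [lra| |].
  - intros s Hs.
    assert (Hs1 : Rabs s < 1) by (apply Rabs_unit; lra).
    evar_last.
    + apply (is_derive_mult (h alpha beta) (fun s => Rpower (1 - s) beta) s).
      * apply is_derive_h; [lra|lra|exact Hs1].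
      * apply is_derive_Rpower_one_minus; lra.
      * intros; apply Rmult_comm.
    + unfold plus, mult; simpl.
      assert (E := h_contiguous alpha beta s Ha ltac:(lra) Hs1).
      replace (- beta * (alpha + beta + 2) / (1 + beta) * h alpha (beta + 1) s)
        with ((1 - s) * h' alpha beta s - beta * h alpha beta s)
        by (rewrite E; field; lra).
      field; lra.
  - intros s Hs; apply Rmult_le_pos.
    + apply Rlt_le, Rdiv_lt_0_compat; [apply Rpower_pos|lra].
    + apply Rmult_le_pos; [|apply h_nonneg; lra].
      apply Rdiv_le_0_compat; [|lra].
      apply Rmult_le_pos; lra. }
rewrite Rpower_Ropp.
apply Rmult_le_reg_r with (Rpower (1 - t) beta); [apply Rpower_pos|].
rewrite Rinv_l; [exact Hq|apply Rgt_not_eq, Rpower_pos].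
Qed.

Lemma h_pos (alpha beta t : R) :
  -1 < alpha -> -1 < beta <= 0 -> 0 <= t < 1 -> 0 < h alpha beta t.
Proof.
intros Ha Hb Ht; apply Rlt_le_trans with (1 := Rpower_pos (1 - t) (- beta)).
apply h_lower_bound; assumption.
Qed.

Lemma Rpower_le_h (alpha beta a t : R) :
  -1 < alpha -> -1 < beta <= 0 -> 0 <= t < 1 -> - beta <= a ->
  Rpower (1 - t) a <= h alpha beta t.
Proof.
intros Ha Hb Ht Hba.
apply Rle_trans with (2 := h_lower_bound alpha beta t Ha Hb Ht).
assert (Hln : ln (1 - t) <= 0) by (rewrite <- ln_1; apply ln_le; lra).
assert (He : a * ln (1 - t) <= - beta * ln (1 - t)) by nra.
destruct (Rle_lt_or_eq_dec _ _ He) as [Hlt|Heq].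
- apply Rlt_le, exp_increasing, Hlt.
- unfold Rpower; rewrite Heq; apply Rle_refl.
Qed.

(** [h_euler] for [beta] and [beta + 1] shows that [y = h - g] satisfies
    [t y' + (beta + 1) y = h - (1 - t)^(alpha+1)], and the right-hand side is
    nonnegative by [Rpower_le_h]; this is where [alpha + beta + 1 >= 0]
    enters. *)
Lemma h_shift_le (alpha beta t : R) :
  0 <= alpha + beta + 1 -> -1 < alpha -> -1 < beta <= 0 -> 0 <= t < 1 ->
  h alpha (beta + 1) t <= h alpha beta t.
Proof.
intros Hab Ha Hb Ht; apply Rminus_le_0; revert t Ht.
apply (euler_nonneg (fun t => h alpha beta t - h alpha (beta + 1) t)
  (fun t => h' alpha beta t - h' alpha (beta + 1) t) (beta + 1)); [lra| | |].
- rewrite !h_0; lra.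
- intros s Hs; apply (is_derive_minus (V := R_NormedModule));
    (apply is_derive_h; [lra|lra|apply Rabs_unit, Hs]).
- intros s Hs; rewrite Rmult_minus_distr_l, !h_euler
    by (try apply Rabs_unit; lra).
  assert (H1 := Rpower_le_h alpha beta (alpha + 1) s Ha Hb
    ltac:(lra) ltac:(lra)).
  lra.
Qed.

(** * The radial profile of the logarithm of the kernel *)

Definition log_kernel (alpha beta t : R) : R :=
  ln (h alpha beta t) - (2 + alpha) * ln (1 - t).

Definition log_kernel' (alpha beta t : R) : R :=
  h' alpha beta t / h alpha beta t + (2 + alpha) / (1 - t).

Lemma is_derive_log_kernel (alpha beta t : R) :
  -1 < alpha -> -1 < beta <= 0 -> 0 <= t < 1 ->
  is_derive (log_kernel alpha beta) t (log_kernel' alpha beta t).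
Proof.
intros Ha Hb Ht.
assert (Hh := h_pos alpha beta t Ha Hb Ht).
assert (Hd := is_derive_h alpha beta t Ha (proj1 Hb) (Rabs_unit t Ht)).
unfold log_kernel; auto_derive.
- repeat split; [eexists; exact Hd|exact Hh|lra].
- replace (Derive _ t) with (h' alpha beta t)
    by (symmetry; apply is_derive_unique, Hd).
  unfold log_kernel', Rminus; field; lra.
Qed.

Definition rho2_formula (alpha beta t : R) : R :=
  - beta * (Rpower (1 - t) alpha / h alpha beta t ^ 2)
    * ((alpha + beta + 1) * h alpha beta t
       - beta * (alpha + beta + 2) / (1 + beta) * h alpha (beta + 1) t)
  + (alpha + 2) / (1 - t) ^ 2.

(** [h_euler] rewrites the function, near [t], as an expression without [h'],
    which avoids second derivatives of [h]. *)
Lemma is_derive_euler_log_kernel (alpha beta t : R) :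
  -1 < alpha -> -1 < beta <= 0 -> 0 <= t < 1 ->
  is_derive (fun s => s * log_kernel' alpha beta s) t (rho2_formula alpha beta t).
Proof.
intros Ha Hb Ht.
assert (Ht1 := Rabs_unit t Ht).
assert (Hh := h_pos alpha beta t Ha Hb Ht).
assert (Hd := is_derive_h alpha beta t Ha (proj1 Hb) Ht1).
apply is_derive_ext_loc with (fun s =>
  beta * Rpower (1 - s) (alpha + 1) * / h alpha beta s - beta
  + (2 + alpha) * (/ (1 - s) - 1)).
- assert (Hc : continuous (h alpha beta) t).
  { apply (ex_derive_continuous (V := R_NormedModule)).
    eexists; exact Hd. }
  assert (Hloc : locally t (fun s => (-1 < s < 1) /\ 0 < h alpha beta s)).
  { apply filter_and.
    - apply (open_and _ _ (open_gt (-1)) (open_lt 1)); lra.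
    - apply (Hc _ (open_gt 0 _ Hh)). }
  revert Hloc; apply filter_imp; intros s [Hs Hhs].
  match goal with |- ?a = ?b => change (@eq R a b) end.
  unfold log_kernel'.
  assert (E := h_euler alpha beta s Ha (proj1 Hb) ltac:(apply Rabs_lt_between, Hs)).
  replace (s * (h' alpha beta s / h alpha beta s + (2 + alpha) / (1 - s)))
    with (s * h' alpha beta s / h alpha beta s + s * (2 + alpha) / (1 - s))
    by (field; lra).
  rewrite E; field; lra.
- evar_last.
  + apply (is_derive_plus (V := R_NormedModule) (fun s =>
      beta * Rpower (1 - s) (alpha + 1) * / h alpha beta s - beta)
      (fun s => (2 + alpha) * (/ (1 - s) - 1))).
    * apply (is_derive_minus (V := R_NormedModule)); [|apply is_derive_const].
      apply (is_derive_mult (fun s => beta * Rpower (1 - s) (alpha + 1))).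
      -- apply (is_derive_scal (fun s => Rpower (1 - s) (alpha + 1))).
         apply is_derive_Rpower_one_minus; lra.
      -- apply is_derive_inv; [exact Hd|lra].
      -- intros; apply Rmult_comm.
    * auto_derive; [lra|reflexivity].
  + assert (Hc := h_contiguous alpha beta t Ha (proj1 Hb) Ht1).
    assert (HR : Rpower (1 - t) (alpha + 1) = (1 - t) * Rpower (1 - t) alpha).
    { rewrite Rpower_plus, Rpower_1 by lra; apply Rmult_comm. }
    unfold rho2_formula.
    replace ((alpha + beta + 1) * h alpha beta t
        - beta * (alpha + beta + 2) / (1 + beta) * h alpha (beta + 1) t)
      with ((alpha + 1) * h alpha beta t + (1 - t) * h' alpha beta t)
      by (rewrite Hc; ring).
    rewrite HR; unfold plus, minus, opp, mult, zero; simpl.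
    unfold plus, opp; simpl; field; lra.
Qed.

Lemma ex_derive_log_kernel' (alpha beta t : R) :
  -1 < alpha -> -1 < beta <= 0 -> 0 <= t < 1 ->
  ex_derive (log_kernel' alpha beta) t.
Proof.
intros Ha Hb Ht; assert (Ht1 := Rabs_unit t Ht).
assert (Hh := h_pos alpha beta t Ha Hb Ht).
unfold log_kernel'; apply (ex_derive_plus (V := R_NormedModule)).
- apply ex_derive_div; [|eexists; apply is_derive_h|lra]; try lra.
  apply ex_derive_h'; lra.
- auto_derive; lra.
Qed.

(** Apart from [(alpha + 2) / (1 - t)^2], the formula is [- beta p E / x^2] with
    [p = (1 - t)^alpha] and [x = h t].  It is nonnegative because [E] is, and at
    most [- beta (alpha + 1) / ((1 + beta) (1 - t)^2)] because
    [(1 - t)^2 p <= x] and [E <= (alpha + 1) / (1 + beta) x]. *)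
Lemma rho2_formula_bounds (alpha beta t : R) :
  0 <= alpha + beta + 1 -> -1 < alpha -> -1 < beta <= 0 -> 0 <= t < 1 ->
  (alpha + 2) / (1 - t) ^ 2 <= rho2_formula alpha beta t
    <= (alpha + beta + 2) / (1 + beta) * (1 / (1 - t) ^ 2).
Proof.
intros Hab Ha Hb Ht; unfold rho2_formula.
assert (Hh := h_pos alpha beta t Ha Hb Ht).
assert (HG := h_nonneg alpha (beta + 1) t Ha ltac:(lra) Ht).
assert (HGh := h_shift_le alpha beta t Hab Ha Hb Ht).
assert (Hlow := Rpower_le_h alpha beta (alpha + 2) t Ha Hb Ht ltac:(lra)).
assert (HR : Rpower (1 - t) (alpha + 2) = (1 - t) ^ 2 * Rpower (1 - t) alpha).
{ rewrite Rpower_plus, (Rpower_pow 2) by lra; apply Rmult_comm. }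
rewrite HR in Hlow; clear HR.
assert (Hp := Rpower_pos (1 - t) alpha).
set (p := Rpower (1 - t) alpha) in *.
set (x := h alpha beta t) in *; set (G := h alpha (beta + 1) t) in *.
assert (Hk : 0 <= - beta * (alpha + beta + 2) / (1 + beta)).
{ apply Rdiv_le_0_compat; [apply Rmult_le_pos|]; lra. }
set (E := (alpha + beta + 1) * x
  - beta * (alpha + beta + 2) / (1 + beta) * G).
assert (HE : 0 <= E).
{ assert (H1 := Rmult_le_pos _ _ Hk HG).
  assert (H2 := Rmult_le_pos _ _ Hab (Rlt_le _ _ Hh)).
  unfold E; unfold Rdiv in *; lra. }
assert (HEx : E <= (alpha + 1) / (1 + beta) * x).
{ replace ((alpha + 1) / (1 + beta) * x)
    with ((alpha + beta + 1) * x
      + - beta * (alpha + beta + 2) / (1 + beta) * x) by (field; lra).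
  assert (H1 := Rmult_le_compat_l _ _ _ Hk HGh).
  unfold E; unfold Rdiv in *; lra. }
assert (Ht2 : 0 < (1 - t) ^ 2) by (apply pow_lt; lra).
split.
- assert (H1 : 0 <= - beta * (p / x ^ 2) * E); [|lra].
  apply Rmult_le_pos; [|exact HE]; apply Rmult_le_pos; [lra|].
  apply Rlt_le, Rdiv_lt_0_compat; [exact Hp|apply pow_lt, Hh].
- assert (H1 : - beta * (p / x ^ 2) * E
    <= - beta * ((alpha + 1) / (1 + beta)) / (1 - t) ^ 2).
  { apply Rmult_le_reg_r with (x ^ 2 * (1 - t) ^ 2).
    { apply Rmult_lt_0_compat; [apply pow_lt, Hh|exact Ht2]. }
    replace (- beta * (p / x ^ 2) * E * (x ^ 2 * (1 - t) ^ 2))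
      with (- beta * (((1 - t) ^ 2 * p) * E)) by (field; lra).
    replace (- beta * ((alpha + 1) / (1 + beta)) / (1 - t) ^ 2
        * (x ^ 2 * (1 - t) ^ 2))
      with (- beta * (x * ((alpha + 1) / (1 + beta) * x)))
      by (field; lra).
    apply Rmult_le_compat_l; [lra|].
    apply Rmult_le_compat; [|exact HE|exact Hlow|exact HEx].
    apply Rmult_le_pos; lra. }
  replace ((alpha + beta + 2) / (1 + beta) * (1 / (1 - t) ^ 2))
    with (- beta * ((alpha + 1) / (1 + beta)) / (1 - t) ^ 2
      + (alpha + 2) / (1 - t) ^ 2) by (field; lra).
  lra.
Qed.

(** * Wirtinger derivatives of radial functions *)

(** The norm of [C] is [Cmod] and not the product norm, so the curve is written
    as [u * 1 + v * i] and differentiated as a combination of fixed vectors. *)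
Lemma is_derive_pair (u v : R -> R) (x a b : R) :
  is_derive u x a -> is_derive v x b ->
  is_derive (V := C_R_NormedModule) (fun s => (u s, v s)) x (a, b).
Proof.
intros Hu Hv.
apply (is_derive_ext (V := C_R_NormedModule)
  (fun s => plus (scal (u s) (RtoC 1)) (scal (v s) Ci))).
- intros s; apply injective_projections; simpl;
    unfold plus, scal; simpl; unfold mult; simpl; ring.
- replace (a, b) with (plus (scal a (RtoC 1)) (scal b Ci) : C_R_NormedModule).
  + apply (is_derive_plus (V := C_R_NormedModule));
      apply (is_derive_scal_l (V := C_R_NormedModule)); assumption.
  + apply injective_projections; simpl;
      unfold plus, scal; simpl; unfold mult; simpl; ring.
Qed.

Lemma derive_curve (g : R -> C) (u v : R -> R) (x a b : R) :
  locally x (fun s => g s = (u s, v s)) ->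
  is_derive u x a -> is_derive v x b ->
  ex_derive (V := C_R_NormedModule) g x /\
  (Derive (fun s => Re (g s)) x, Derive (fun s => Im (g s)) x) = (a, b).
Proof.
intros Hg Hu Hv; split.
- exists (a, b); apply (is_derive_ext_loc (V := C_R_NormedModule))
    with (fun s => (u s, v s)).
  + revert Hg; apply filter_imp; intros s Hs; symmetry; exact Hs.
  + apply is_derive_pair; assumption.
- f_equal; apply is_derive_unique.
  + apply is_derive_ext_loc with u; [|exact Hu].
    revert Hg; apply filter_imp; intros s Hs; rewrite Hs; reflexivity.
  + apply is_derive_ext_loc with v; [|exact Hv].
    revert Hg; apply filter_imp; intros s Hs; rewrite Hs; reflexivity.
Qed.

Lemma Cmod_pair_sqr (x y : R) : Cmod (x, y) ^ 2 = x ^ 2 + y ^ 2.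
Proof. apply pow2_sqrt; simpl; nra. Qed.

Lemma Cmod_sqr_range (z : C) : Cmod z < 1 -> 0 <= Cmod z ^ 2 < 1.
Proof. intros Hz; assert (H0 := Cmod_ge_0 z); simpl; nra. Qed.

Lemma Cmod_pair_lt_1 (x y : R) : x ^ 2 + y ^ 2 < 1 -> Cmod (x, y) < 1.
Proof.
rewrite <- Cmod_pair_sqr; assert (H0 := Cmod_ge_0 (x, y)); simpl; nra.
Qed.

Lemma locally_disc_x (x y : R) : x ^ 2 + y ^ 2 < 1 ->
  locally x (fun s => s ^ 2 + y ^ 2 < 1).
Proof.
intros Hxy.
assert (Hc : continuous (fun s : R => s ^ 2 + y ^ 2) x).
{ apply (ex_derive_continuous (V := R_NormedModule)); auto_derive; trivial. }
apply (Hc _ (open_lt 1 _ Hxy)).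
Qed.

Lemma locally_disc_y (x y : R) : x ^ 2 + y ^ 2 < 1 ->
  locally y (fun s => x ^ 2 + s ^ 2 < 1).
Proof.
intros Hxy; rewrite Rplus_comm in Hxy.
assert (H := locally_disc_x y x Hxy); revert H.
apply filter_imp; intros s Hs; rewrite Rplus_comm; exact Hs.
Qed.

Lemma partials (f : C -> C) (x y : R) (u v : R -> R -> R)
    (ux vx uy vy : R) :
  x ^ 2 + y ^ 2 < 1 ->
  (forall a b, a ^ 2 + b ^ 2 < 1 -> f (a, b) = (u a b, v a b)) ->
  is_derive (fun a => u a y) x ux -> is_derive (fun a => v a y) x vx ->
  is_derive (fun b => u x b) y uy -> is_derive (fun b => v x b) y vy ->
  ex_partials f (x, y) /\
  D_z f (x, y) = ((ux + vy) / 2, (vx - uy) / 2) /\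
  D_zbar f (x, y) = ((ux - vy) / 2, (vx + uy) / 2).
Proof.
intros Hxy Hf Hux Hvx Huy Hvy.
destruct (derive_curve (fun a => f (a, y)) (fun a => u a y) (fun a => v a y)
  x ux vx) as [Ex Dxf]; try assumption.
{ generalize (locally_disc_x x y Hxy); apply filter_imp.
  intros s Hs; apply Hf, Hs. }
destruct (derive_curve (fun b => f (x, b)) (u x) (v x) y uy vy)
  as [Ey Dyf]; try assumption.
{ generalize (locally_disc_y x y Hxy); apply filter_imp.
  intros s Hs; apply Hf, Hs. }
assert (HDx : Defs.Dx f (x, y) = (ux, vx)) by exact Dxf.
assert (HDy : Dy f (x, y) = (uy, vy)) by exact Dyf.
split; [split; assumption|].
unfold D_z, D_zbar; rewrite HDx, HDy.
split; apply injective_projections; simpl; field.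
Qed.

Lemma radial_D_zbar (f : C -> C) (phi phi' : R -> R) :
  (forall w, Cmod w < 1 -> f w = RtoC (phi (Cmod w ^ 2))) ->
  (forall t, 0 <= t < 1 -> is_derive phi t (phi' t)) ->
  forall x y, x ^ 2 + y ^ 2 < 1 ->
  ex_partials f (x, y) /\
  D_zbar f (x, y) = (x * phi' (x ^ 2 + y ^ 2), y * phi' (x ^ 2 + y ^ 2)).
Proof.
intros Hf Hd x y Hxy.
assert (Hd' := Hd (x ^ 2 + y ^ 2) ltac:(nra)).
destruct (partials f x y (fun a b => phi (a ^ 2 + b ^ 2)) (fun _ _ => 0)
  (2 * x * phi' (x ^ 2 + y ^ 2)) 0 (2 * y * phi' (x ^ 2 + y ^ 2)) 0)
  as [Hex [_ HD]]; try exact Hxy.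
- intros a b Hab; rewrite Hf by (apply Cmod_pair_lt_1, Hab).
  rewrite Cmod_pair_sqr; reflexivity.
- apply (is_derive_comp (V := R_NormedModule) phi (fun a => a ^ 2 + y ^ 2));
    [exact Hd'|auto_derive; [trivial|ring]].
- apply (is_derive_const (V := R_NormedModule)).
- apply (is_derive_comp (V := R_NormedModule) phi (fun b => x ^ 2 + b ^ 2));
    [exact Hd'|auto_derive; [trivial|ring]].
- apply (is_derive_const (V := R_NormedModule)).
- split; [exact Hex|]; rewrite HD; f_equal; field.
Qed.

(** The first derivative is [D_zbar f w = w * phi' (|w|^2)], a function with real
    components [x phi'] and [y phi'].  Differentiating again gives
    [phi' + t phi''], which is [(t phi')']. *)
Lemma radial_D_z_D_zbar (f : C -> C) (phi phi' : R -> R) (z : C) (l : R) :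
  (forall w, Cmod w < 1 -> f w = RtoC (phi (Cmod w ^ 2))) ->
  (forall t, 0 <= t < 1 -> is_derive phi t (phi' t)) ->
  Cmod z < 1 -> ex_derive phi' (Cmod z ^ 2) ->
  is_derive (fun t => t * phi' t) (Cmod z ^ 2) l ->
  ex_partials f z /\ ex_partials (D_zbar f) z /\ D_z (D_zbar f) z = RtoC l.
Proof.
destruct z as [x y]; intros Hf Hd Hz Hex Hl.
apply Cmod_sqr_range in Hz; rewrite Cmod_pair_sqr in *.
destruct Hz as [_ Hxy].
assert (HD := radial_D_zbar f phi phi' Hf Hd).
split; [apply HD, Hxy|].
set (t := x ^ 2 + y ^ 2) in *.
destruct Hex as [phi'' Hd'].
assert (El : phi' t + t * phi'' = l).
{ transitivity (Derive (fun t => t * phi' t) t);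
    [symmetry|]; apply is_derive_unique; [|exact Hl].
  evar_last.
  - apply (is_derive_mult (fun t => t) phi'); [apply is_derive_id|exact Hd'|].
    intros; apply Rmult_comm.
  - unfold plus, mult, one; simpl; ring. }
assert (Hx : is_derive (fun a => phi' (a ^ 2 + y ^ 2)) x (2 * x * phi'')).
{ apply (is_derive_comp (V := R_NormedModule) phi' (fun a => a ^ 2 + y ^ 2));
    [exact Hd'|auto_derive; [trivial|ring]]. }
assert (Hy : is_derive (fun b => phi' (x ^ 2 + b ^ 2)) y (2 * y * phi'')).
{ apply (is_derive_comp (V := R_NormedModule) phi' (fun b => x ^ 2 + b ^ 2));
    [exact Hd'|auto_derive; [trivial|ring]]. }
destruct (partials (D_zbar f) x y (fun a b => a * phi' (a ^ 2 + b ^ 2))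
  (fun a b => b * phi' (a ^ 2 + b ^ 2))
  (phi' t + x * (2 * x * phi'')) (y * (2 * x * phi''))
  (x * (2 * y * phi'')) (phi' t + y * (2 * y * phi'')))
  as [Hex [HDz _]]; try exact Hxy.
- intros a b Hab; apply HD, Hab.
- evar_last.
  + apply (is_derive_mult (fun a => a) (fun a => phi' (a ^ 2 + y ^ 2)));
      [apply is_derive_id|exact Hx|intros; apply Rmult_comm].
  + unfold plus, mult, one; simpl; fold t; unfold t; simpl; ring.
- apply (is_derive_scal (fun a => phi' (a ^ 2 + y ^ 2))); exact Hx.
- apply (is_derive_scal (fun b => phi' (x ^ 2 + b ^ 2))); exact Hy.
- evar_last.
  + apply (is_derive_mult (fun b => b) (fun b => phi' (x ^ 2 + b ^ 2)));
      [apply is_derive_id|exact Hy|intros; apply Rmult_comm].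
  + unfold plus, mult, one; simpl; unfold t; simpl; ring.
- split; [exact Hex|].
  rewrite HDz, <- El; unfold t, RtoC; f_equal; field.
Qed.

(** * The kernel on the diagonal *)

Lemma H_RtoC (alpha beta t : R) :
  H alpha beta (RtoC t) = RtoC (h alpha beta t).
Proof.
assert (Hterm : forall n, (Hcoef alpha beta n * RtoC t ^ n)%C
  = RtoC (Hcoef alpha beta n * t ^ n)).
{ intros n; rewrite <- RtoC_pow, <- RtoC_mult; reflexivity. }
unfold H, CSeries.
apply (f_equal2 (@pair R R)).
- apply Series_ext; intros n; rewrite Hterm; reflexivity.
- rewrite <- (PSeries_const_0 0); unfold PSeries; apply Series_ext.
  intros n; rewrite Hterm; simpl; ring.
Qed.

Lemma Clog_RtoC (x : R) : 0 < x -> Clog (RtoC x) = RtoC (ln x).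
Proof.
intros Hx; unfold Clog, Carg; rewrite Cmod_R, Rabs_right by lra; simpl.
destruct (Rlt_dec 0 0) as [H0|_]; [lra|].
unfold Rdiv; rewrite Rinv_r, acos_1 by lra; reflexivity.
Qed.

Lemma Cpower_RtoC (x a : R) : 0 < x -> Cpower (RtoC x) a = RtoC (Rpower x a).
Proof.
intros Hx; unfold Cpower; rewrite Clog_RtoC, <- RtoC_mult by exact Hx.
unfold Cexp; simpl; rewrite cos_0, sin_0, Rmult_1_r, Rmult_0_r; reflexivity.
Qed.

(** [w * Cconj w] is the real number [|w|^2], and both [h] and [1 - |w|^2] are
    positive there, so the complex logarithm and power are the real ones. *)
Lemma kappa_radial (alpha beta : R) (w : C) :
  -1 < alpha -> -1 < beta <= 0 -> Cmod w < 1 ->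
  kappa alpha beta w = RtoC (log_kernel alpha beta (Cmod w ^ 2)).
Proof.
intros Ha Hb Hw; apply Cmod_sqr_range in Hw.
unfold kappa, K; rewrite <- Cmod2_conj.
set (t := Cmod w ^ 2) in *.
assert (Hh := h_pos alpha beta t Ha Hb Hw).
assert (Hp := Rpower_pos (1 - t) (2 + alpha)).
rewrite <- RtoC_minus, Cpower_RtoC, H_RtoC, <- RtoC_div by lra.
rewrite Clog_RtoC by (apply Rdiv_lt_0_compat; assumption).
unfold log_kernel; rewrite ln_div by assumption.
unfold Rpower at 1; rewrite ln_exp; reflexivity.
Qed.

Theorem theorem3 (alpha beta : R) (halpha : -1 < alpha)
  (hbeta : -1 < beta <= 0) (z : C) (hz : Cmod z < 1) :
  let t := Cmod z ^ 2 in
  (ex_partials (kappa alpha beta) z /\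
   ex_partials (D_zbar (kappa alpha beta)) z) /\
  rho2 alpha beta z =
    (- beta * (Rpower (1 - t) alpha / (H alpha beta t) ^ 2)
       * ((alpha + beta + 1) * H alpha beta t
          - beta * (alpha + beta + 2) / (1 + beta) * H alpha (beta + 1) t)
     + (alpha + 2) / (1 - t) ^ 2)%C /\
  ((exists m : nat, alpha = INR m) ->
   (alpha + 2) / (1 - t) ^ 2 <= Re (rho2 alpha beta z)
     <= (alpha + beta + 2) / (1 + beta) * (1 / (1 - t) ^ 2)).
Proof.
intros t.
assert (Ht := Cmod_sqr_range z hz); fold t in Ht.
destruct (radial_D_z_D_zbar (kappa alpha beta) (log_kernel alpha beta)
  (log_kernel' alpha beta) z (rho2_formula alpha beta t)) as [E1 [E2 Hrho]].
- intros w Hw; apply kappa_radial; assumption.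
- intros s Hs; apply is_derive_log_kernel; assumption.
- exact hz.
- apply ex_derive_log_kernel'; assumption.
- apply is_derive_euler_log_kernel; assumption.
- fold (rho2 alpha beta z) in Hrho.
  split; [split; assumption|]; rewrite Hrho; split.
  + assert (Hh := h_pos alpha beta t halpha hbeta Ht).
    assert (Hh2 : h alpha beta t ^ 2 <> 0) by (apply pow_nonzero; lra).
    assert (Ht2 : (1 - t) ^ 2 <> 0) by (apply pow_nonzero; lra).
    rewrite !H_RtoC; unfold rho2_formula.
    repeat first [rewrite RtoC_plus | rewrite RtoC_minus | rewrite RtoC_mult
      | rewrite RtoC_opp | rewrite RtoC_pow
      | rewrite RtoC_div by (assumption || lra)].
    reflexivity.
  + intros [m Hm]; apply rho2_formula_bounds; try assumption.
    assert (H0 := pos_INR m); lra.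
Qed.
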